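(* For every integer $n\geq 3$, $\kappa_{3}(Q_{n}^{3})\leq 8n-12$.
   Context: The $3$-ary $n$-cube $Q_n^3$ is the graph whose vertices are the strings $u=u_{n-1}u_{n-2}\cdots u_0$ with $u_i\in\{0,1,2\}$, two vertices $u,v$ being adjacent if and only if there is an index $j$ with $u_j=v_j\pm 1 \pmod 3$ and $u_i=v_i$ for all $i\neq j$. For a connected graph $G$ and an integer $h\geq 0$, a vertex set $S\subseteq V(G)$ is an $h$-extra vertex cut if $G-S$ is disconnected and every component of $G-S$ has at least $h+1$ vertices; the $h$-extra connectivity $\kappa_h(G)$ is the minimum cardinality of an $h$-extra vertex cut of $G$. *)

(* Defs.v *)
From mathcomp Require Import all_boot all_order all_algebra.
Set Implicit Arguments.
Unset Strict Implicit.
Unset Printing Implicit Defensive.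

Section ExtraConnectivity.
Variables (T : finType) (e : rel T).
Implicit Types (A S C : {set T}) (h : nat).

Definition induced A : rel T := [rel x y | [&& x \in A, y \in A & e x y]].

Definition component A (x : T) : {set T} :=
  [set y in A | connect (induced A) x y].

Definition components A : {set {set T}} := [set component A x | x in A].

(* The empty vertex set induces a graph that is not disconnected. *)
Definition disconnected A : bool :=
  [exists x in A, exists y in A, ~~ connect (induced A) x y].

Definition extra_vertex_cut h S : bool :=
  disconnected (~: S) && [forall C in components (~: S), h.+1 <= #|C|].

(* The value is #|T| when there is no h-extra vertex cut; no cut has that     *)
(* cardinality, since the complement of a cut is nonempty.                    *)
Definition extra_connectivity h : nat :=
  \big[minn/#|T|]_(S : {set T} | extra_vertex_cut h S) #|S|.

Lemma extra_connectivity_le h S :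
  extra_vertex_cut h S -> extra_connectivity h <= #|S|.
Proof.
move=> cutS; rewrite /extra_connectivity.
have: S \in index_enum {set T} by exact: mem_index_enum.
elim: (index_enum _) => //= C s IHs.
rewrite inE big_cons => /predU1P[<-|/IHs le_sS]; first by rewrite cutS geq_minl.
by case: ifP => // _; rewrite geq_min le_sS orbT.
Qed.

Lemma extra_vertex_cut_lt h S : extra_vertex_cut h S -> #|S| < #|T|.
Proof.
case/andP=> /exists_inP[x]; rewrite inE => xS _ _.
rewrite -cardsT; apply: proper_card; rewrite properE subsetT.
by apply/subsetPn; exists x.
Qed.

Lemma extra_connectivity_attained h :
  extra_connectivity h < #|T| ->
  exists2 S, extra_vertex_cut h S & #|S| = extra_connectivity h.
Proof.
rewrite /extra_connectivity.
elim/big_rec: _ => [|S m cutS IHm]; first by rewrite ltnn.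
by case: (leqP #|S| m) => // _ _; exists S.
Qed.

End ExtraConnectivity.

Section TernaryCube.
Import GRing.Theory.
Local Open Scope ring_scope.
Variable n : nat.

Definition cube3_vertex : finType := {ffun 'I_n -> 'Z_3}.

Definition cube3_adj : rel cube3_vertex := fun u v =>
  [exists j : 'I_n, ((u j == v j + 1) || (u j == v j - 1))
                    && [forall i : 'I_n, (i != j) ==> (u i == v i)]].

Lemma cube3_adj_sym : symmetric cube3_adj.
Proof.
have sub u v : cube3_adj u v -> cube3_adj v u.
  case/existsP=> j /andP[uvj /forallP uvN]; apply/existsP; exists j.
  apply/andP; split; last by apply/forallP=> i; rewrite (eq_sym (v i)).
  by case/orP: uvj => /eqP->; rewrite ?addrK ?subrK eqxx ?orbT.
by move=> u v; apply/idP/idP; apply: sub.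
Qed.

Lemma cube3_adj_irrefl : irreflexive cube3_adj.
Proof.
move=> u; apply/negbTE/negP=> /existsP[j /andP[+ _]].
by case: (u j) => [[|[|[|]]] ?].
Qed.

Lemma cube3_connected (u v : cube3_vertex) : connect cube3_adj u v.
Proof.
have [m] := ubnP #|[set i | u i != v i]|; elim: m u => // m IHm u; rewrite ltnS.
have [d0 _|[j]] := set_0Vmem [set i | u i != v i].
  have -> // : u = v; apply/ffunP=> i; apply/eqP.
  by have := in_set0 i; rewrite -d0 inE => /negbFE.
move=> dj; rewrite (cardsD1 j) dj add1n => lt_m.
pose w : cube3_vertex := [ffun i => if i == j then v j else u i].
apply: (@connect_trans _ _ w); last first.
  apply: IHm; apply: leq_ltn_trans lt_m; apply/subset_leq_card/subsetP=> i.
  by rewrite !inE ffunE; case: (i =P j) => [->|]; rewrite ?eqxx.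
apply/connect1/existsP; exists j; apply/andP; split; last first.
  by apply/forallP=> i; apply/implyP=> /negPf ij; rewrite ffunE ij.
move: dj; rewrite inE ffunE eqxx.
by move: (u j) (v j) => [[|[|[|]]] ?] // [[|[|[|]]] ?].
Qed.

End TernaryCube.

(* Main.v *)
Require Import Defs.
From mathcomp Require Import all_boot all_order all_algebra.
From mathcomp Require Import zify.
Set Implicit Arguments.
Unset Strict Implicit.
Unset Printing Implicit Defensive.

(** The cut is the neighbourhood of a 4-cycle.  Let two coordinates
   [i0], [i1] take values in {0,1} and all the others the value 0; call a
   coordinate of [x] bad when it violates this.  The vertices without bad
   coordinate form a 4-cycle, those with exactly one form its neighbourhood,
   of size 2 + 2 + 8(n - 2), and the others form the far side.  Making a
   coordinate bad never leaves the far side, so every far vertex is connected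
   to one with three bad coordinates, and changing any single coordinate of
   the latter stays on the far side. *)

(** Lets a lower bound on the size of a component be proved at a more convenient vertex connected to
    the given one. *)
Lemma component_trans (T : finType) (e : rel T) (A : {set T}) x y :
  connect (induced e A) x y -> component e A y \subset component e A x.
Proof.
move=> cxy; apply/subsetP=> z; rewrite !inE => /andP[-> cyz].
exact: connect_trans cxy cyz.
Qed.

Section Cube.
Variable n : nat.
Implicit Types (x y : cube3_vertex n) (i j : 'I_n) (c : 'Z_3).

Definition update x i c : cube3_vertex n :=
  [ffun j => if j == i then c else x j].

Lemma update_id x i : update x i (x i) = x.
Proof. by apply/ffunP=> j; rewrite ffunE; case: eqP => // ->. Qed.

(** In Z/3 any two distinct values differ by 1 or -1, so every change of a single coordinate is an
    edge. *)
Lemma cube3_adj_update x i c : x i != c -> cube3_adj x (update x i c).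
Proof.
move=> xic; apply/existsP; exists i; apply/andP; split; last first.
  by apply/forallP=> j; apply/implyP=> /negPf ij; rewrite ffunE ij.
rewrite ffunE eqxx; move: (x i) c xic.
by move=> [[|[|[|]]] ?] // [[|[|[|]]] ?].
Qed.

(** When [c] is already the value of [x] at [i] the path is empty, so uses need not check that the
    coordinate really changes. *)
Lemma connect_update (A : {set cube3_vertex n}) x i c :
    x \in A -> update x i c \in A ->
  connect (induced (@cube3_adj n) A) x (update x i c).
Proof.
have [<-|xic] := eqVneq (x i) c; first by rewrite update_id.
by move=> xA uA; apply: connect1; rewrite /induced /= xA uA cube3_adj_update.
Qed.

Variables i0 i1 i2 : 'I_n.
Hypotheses (i10 : i1 != i0) (i20 : i2 != i0) (i21 : i2 != i1).

Definition good i : {set 'Z_3} :=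
  [set c : 'Z_3 |
    if (i == i0) || (i == i1) then c != 2 :> nat else c == 0 :> nat].

Definition bad x : {set 'I_n} := [set i | x i \notin good i].

Definition one_bad : {set cube3_vertex n} := [set x | #|bad x| == 1].

Lemma card_good i : #|good i| = if (i == i0) || (i == i1) then 2 else 1.
Proof.
rewrite -sum1_card big_mkcond !big_ord_recl big_ord0 !inE.
by case: (_ || _).
Qed.

(** Vertices whose only bad coordinate is [i] form a product: the complement of [good i] at [i], and
    [good j] at every other [j]. The sizes multiply to 1 * 2 if [i] is [i0] or [i1], and to 2 * 2 *
    2 otherwise. *)
Lemma card_bad_eq1 i :
  #|[set x | bad x == [set i]]| = if (i == i0) || (i == i1) then 2 else 8.
Proof.
pose F j := if j == i then ~: good j else good j.
have -> : #|[set x | bad x == [set i]]| = #|family F|.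
  apply: eq_card => x; rewrite inE; apply/eqP/familyP => [bx j|Fx].
    rewrite /F; have := in_set1 j i; rewrite -bx inE.
    by case: eqP => _; rewrite ?inE => // /negbFE.
  apply/setP=> j; have := Fx j; rewrite /F !inE.
  by case: eqP => _; rewrite ?inE // => ->.
have cF j : #|F j| = if j == i then 3 - #|good j| else #|good j|.
  by rewrite /F; case: ifP => // _; rewrite cardsCs setCK card_ord.
rewrite card_family foldrE big_image /=.
rewrite (bigD1 i0) //= (bigD1 i1) //= !cF !card_good !eqxx orbT.
rewrite !(eq_sym _ i).
have F1 j : j != i -> (j != i0) && (j != i1) -> #|F j| = 1.
  by move=> /negPf ji /andP[/negPf j0 /negPf j1]; rewrite cF ji card_good j0 j1.
have [ii0|ii0] /= := eqVneq i i0.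
  rewrite ii0 eq_sym (negPf i10) big1 // => j /[dup] /andP[? _].
  by apply: F1; rewrite ii0.
have [ii1|ii1] /= := eqVneq i i1.
  by rewrite big1 // => j /[dup] /andP[_ ?]; apply: F1; rewrite ii1.
rewrite (bigD1 i) ?ii0 //= cF eqxx card_good (negPf ii0) (negPf ii1) /=.
by rewrite big1 // => j /andP[jc ji]; apply: F1.
Qed.

Lemma card_one_bad : #|one_bad| <= 8 * n - 12.
Proof.
have -> : one_bad = \bigcup_i [set x | bad x == [set i]].
  apply/setP=> x; rewrite inE; apply/cards1P/bigcupP => [[i bx]|[i _]].
    by exists i; rewrite ?inE ?bx.
  by rewrite inE => /eqP; exists i.
apply: (@leq_trans (\sum_i #|[set x | bad x == [set i]]|)).
  elim/big_ind2: _ => [|A m B k Am Bk|//]; first by rewrite cards0.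
  by apply: leq_trans (leq_card_setU _ _) _; apply: leq_add.
under eq_bigr do rewrite card_bad_eq1.
rewrite (bigD1 i0) //= (bigD1 i1) //= !eqxx orbT.
under eq_bigr => i /andP[/negPf-> /negPf->] do [].
(* Writing [n] as 2 + m turns both sides into 4 + 8m, so the truncated subtraction in the bound is
   harmless. *)
have n2 : 2 + #|[pred i | (i != i0) && (i != i1)]| = n.
  rewrite -[RHS]card_ord -(cardC (pred2 i0 i1)) card2 eq_sym i10.
  by congr (_ + _); apply: eq_card => i; rewrite !inE negb_or.
by rewrite sum_nat_const /=; move: n2; set m := #|_|; lia.
Qed.

Lemma bad_update_bad x i c : c \notin good i -> bad (update x i c) = i |: bad x.
Proof.
move=> cb; apply/setP=> j; rewrite in_setU1 [LHS]inE [j \in bad x]inE ffunE.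
by case: eqP => [->|].
Qed.

Lemma bad_update_good x i c : c \in good i -> bad (update x i c) = bad x :\ i.
Proof.
move=> cb; apply/setP=> j; rewrite in_setD1 [LHS]inE [j \in bad x]inE ffunE.
by case: eqP => [->|//]; rewrite cb.
Qed.

(** A move changes one coordinate, so [y] has at most one bad coordinate; having exactly one would
    put it in the cut. *)
Lemma no_bad_adj x y :
  bad x = set0 -> y \in ~: one_bad -> cube3_adj x y -> bad y = set0.
Proof.
move=> bx; rewrite !inE => yS /existsP[j /andP[_ /forallP xy]].
have sub : bad y \subset [set j].
  apply/subsetP=> i; rewrite in_set1; apply: contraTT => ij.
  by have := in_set0 i; have := xy i; rewrite ij -bx !inE => /eqP-> /negbT.
have := subset_leq_card sub; rewrite cards1 leq_eqVlt (negPf yS) ltnS leqn0.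
by rewrite cards_eq0 => /eqP.
Qed.

Lemma connect_no_bad x y :
    bad x = set0 -> connect (induced (@cube3_adj n) (~: one_bad)) x y ->
  bad y = set0.
Proof.
move=> bx /connectP[p]; elim: p x bx => [|z p IHp] x bx /=; first by move=> _ ->.
case/andP=> /and3P[_ zA xz] pth; apply: IHp pth.
exact: no_bad_adj zA xz.
Qed.

(** Setting [i0] and then [i1] to 0 or 1 reaches all of the 4-cycle without ever creating a bad
    coordinate. *)
Lemma card_component_no_bad x :
  bad x = set0 -> 4 <= #|component (@cube3_adj n) (~: one_bad) x|.
Proof.
move=> bx; pose u (b c : 'Z_3) := update (update x i0 b) i1 c.
have good01 i (b : 'Z_3) : (i == i0) || (i == i1) -> b != 2 :> nat -> b \in good i.
  by move=> ii b2; rewrite inE ii.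
have uC (b c : 'Z_3) : b != 2 :> nat -> c != 2 :> nat ->
    u b c \in component (@cube3_adj n) (~: one_bad) x.
  move=> b2 c2.
  have bb : bad (update x i0 b) = set0.
    by rewrite bad_update_good ?good01 ?eqxx // bx set0D.
  have bu : bad (u b c) = set0.
    by rewrite bad_update_good ?good01 ?eqxx ?orbT // bb set0D.
  rewrite inE inE inE bu cards0 /=.
  by apply: (connect_trans (y := update x i0 b)); apply: connect_update;
    rewrite !inE ?bx ?bb ?bu cards0.
pose s := [:: u 0 0; u 0 1; u 1 0; u 1 1]%R.
have us : uniq s.
  apply: (map_uniq (f := fun z : cube3_vertex n => (z i0, z i1))).
  by rewrite /= !ffunE !eqxx (eq_sym i0) (negPf i10).
rewrite cardE; apply: (uniq_leq_size us); apply/allP.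
by rewrite /= !mem_enum !uC.
Qed.

Lemma card_component_bad x :
  1 < #|bad x| -> 4 <= #|component (@cube3_adj n) (~: one_bad) x|.
Proof.
move=> bx.
have farS z : 1 < #|bad z| -> z \in ~: one_bad by rewrite !inE; lia.
have raise i c z : c \notin good i -> 1 < #|bad z| ->
    1 < #|bad (update z i c)| /\
    connect (induced (@cube3_adj n) (~: one_bad)) z (update z i c).
  move=> cb bz; have bu : 1 < #|bad (update z i c)|.
    by rewrite bad_update_bad // (leq_trans bz) ?subset_leq_card ?subsetUr.
  by split=> //; apply: connect_update; apply: farS.
(* The value 2 is bad at [i0] and [i1], and 1 is bad at [i2]; each update thus stays on the far
   side, and [y] is bad at all three. *)
pose y0 := update x i0 2%R; pose y1 := update y0 i1 2%R.
pose y := update y1 i2 1%R.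
have bad0 : 2%R \notin good i0 by rewrite inE eqxx.
have bad1 : 2%R \notin good i1 by rewrite inE eqxx orbT.
have bad2 : 1%R \notin good i2 by rewrite inE (negPf i20) (negPf i21).
have [b0 c0] := raise _ _ _ bad0 bx.
have [b1 c1] := raise _ _ _ bad1 b0.
have [b2 c2] := raise _ _ _ bad2 b1.
apply: leq_trans (subset_leq_card (component_trans _)); last first.
  exact: connect_trans (connect_trans c0 c1) c2.
have by3 : 2 < #|bad y|.
  have : [set i0; i1; i2] \subset bad y.
    rewrite !bad_update_bad //; apply/subsetP=> i; rewrite !inE.
    by case/orP=> [/orP[]|] /eqP->; rewrite eqxx ?orbT.
  move/subset_leq_card; apply: leq_trans.
  by rewrite setUC cardsU1 cards2 !inE negb_or i20 i21 eq_sym i10.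
(* Overwriting one coordinate destroys at most one of the three bad ones, whatever the new value. *)
have by2 i c : 1 < #|bad (update y i c)|.
  have by1 : 1 < #|bad y :\ i|.
    by move: by3; rewrite (cardsD1 i); case: (i \in _) => // /ltnW.
  apply: leq_trans by1 _.
  apply/subset_leq_card/subsetP=> j; rewrite in_setD1.
  by case/andP=> /negPf ji; rewrite ![j \in bad _]inE [update y i c j]ffunE ji.
have yC i : update y i 0%R \in component (@cube3_adj n) (~: one_bad) y.
  by rewrite inE farS //=; apply: connect_update; apply: farS => //; apply: ltnW.
(* At [i0], [i1], [i2] the vertex [y] reads 2, 2, 1, so resetting any one of these to 0 gives three
   further distinct vertices. *)
pose s := [:: y; update y i0 0%R; update y i1 0%R; update y i2 0%R].
have us : uniq s.
  apply: (map_uniq (f := fun z : cube3_vertex n => (z i0, z i1, z i2))).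
  rewrite /= !ffunE !eqxx !(eq_sym i0) (eq_sym i1 i2).
  by rewrite (negPf i10) (negPf i20) (negPf i21).
rewrite cardE; apply: (uniq_leq_size us); apply/allP.
by rewrite /= !mem_enum !yC inE connect0 farS // ltnW.
Qed.

Lemma extra_vertex_cut_one_bad : extra_vertex_cut (@cube3_adj n) 3 one_bad.
Proof.
apply/andP; split; last first.
  apply/forall_inP=> _ /imsetP[x xS ->]; move: xS; rewrite !inE => bx1.
  have [bx|] := ltnP 1 #|bad x|; first exact: card_component_bad.
  rewrite leq_eqVlt (negPf bx1) ltnS leqn0 cards_eq0 => /eqP.
  exact: card_component_no_bad.
(* Disconnection is witnessed by constant vertices: 0 is good at every coordinate and 2 at none. *)
pose x : cube3_vertex n := [ffun=> 0%R].
have bx : bad x = set0.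
  by apply/setP=> i; rewrite !inE ffunE; case: ifP.
pose y : cube3_vertex n := [ffun=> 2%R].
have y_bad : bad y = setT.
  by apply/setP=> i; rewrite !inE ffunE; case: ifP.
apply/exists_inP; exists x; first by rewrite !inE bx cards0.
(* Three distinct indices force [n] to be at least 3, so [y], with [n] bad coordinates, avoids the
   cut. *)
have n3 : 2 < n.
  move: i10 i20 i21 (ltn_ord i0) (ltn_ord i1) (ltn_ord i2).
  by rewrite -!val_eqE /=; lia.
apply/exists_inP; exists y; first by rewrite !inE y_bad cardsT card_ord; lia.
apply/negP=> /(connect_no_bad bx); rewrite y_bad => /setP/(_ i0).
by rewrite !inE.
Qed.

End Cube.

Theorem theorem3p5 (n : nat) (hn : 3 <= n) :
  extra_connectivity (@cube3_adj n) 3 <= 8 * n - 12.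
Proof.
case: n hn => [|[|[|n]]] // _.
(* [inord] is faithful only within range; 0, 1 and 2 always are, hence they give distinct
   indices. *)
pose i k : 'I_n.+3 := inord k.
have iE k l : k < 3 -> l < 3 -> (i k == i l) = (k == l).
  by move=> k3 l3; rewrite -val_eqE /= !inordK //; lia.
apply: leq_trans (extra_connectivity_le (S := one_bad (i 0) (i 1)) _) _.
  by apply: (@extra_vertex_cut_one_bad _ _ _ (i 2)); rewrite iE.
by apply: (@card_one_bad _ _ _ (i 2)); rewrite iE.
Qed.
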